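(* Let $q>5$ and let $W\sim\text{Student}(q)$, with density $p$. For $k\in\{0,1,2,3\}$ and $u\in\mathbb{R}$ write $M_{0,1}^{k}(u)=\mathbf{E}\left[W^{k}\,I\{W\leq u\}\right]$. Then for all $u \in \mathbb{R}$, $$M_{0,1}^{0}(u) = \int_{-\infty}^{u}p(t)\,dt,$$ $$M_{0,1}^{1}(u) = -\frac{q}{q-1}\,A_{q}\left(1+\frac{u^{2}}{q}\right)^{-(q-1)/2},$$ $$M_{0,1}^{2}(u) = \frac{q^{3/2}}{\sqrt{q-2}\,(q-1)}\,\frac{A_{q}}{A_{q-2}}\,N_{q-2}^{0}\left(u\sqrt{\frac{q-2}{q}}\right) - \frac{q}{q-1}\,A_{q}\,u\left(1+\frac{u^{2}}{q}\right)^{-(q-1)/2},$$ $$M_{0,1}^{3}(u) = \frac{2q^{2}}{(q-2)(q-1)}\,\frac{A_{q}}{A_{q-2}}\,N_{q-2}^{1}\left(u\sqrt{\frac{q-2}{q}}\right) - \frac{q}{q-1}\,A_{q}\,u^{2}\left(1+\frac{u^{2}}{q}\right)^{-(q-1)/2},$$ where $N_{m}^{k}(v) = \mathbf{E}\left[V^{k}\,I\{V\leq v\}\right]$ for $V\sim\text{Student}(m)$.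
   Context: $I\{\cdot\}$ is the indicator function. $\text{Student}(q)$, for degrees of freedom $q>0$, is the distribution on $\mathbb{R}$ with density $$p(u) = A_{q}\left(1+\frac{u^{2}}{q}\right)^{-(q+1)/2}, \qquad A_{q} = \frac{\Gamma((q+1)/2)}{\sqrt{q\pi}\,\Gamma(q/2)},$$ where $\Gamma$ is Euler's Gamma function. *)

(* Defs.v *)
(* MathComp-Analysis *)
From HB Require Import structures.
From mathcomp Require Import all_boot all_order all_algebra.
From mathcomp Require Import all_classical all_reals all_analysis.

Set Implicit Arguments.
Unset Strict Implicit.
Unset Printing Implicit Defensive.

Import Order.TTheory GRing.Theory Num.Theory.
Import numFieldNormedType.Exports.

Local Open Scope classical_set_scope.
Local Open Scope ring_scope.

(* Real-valued Lebesgue integral; it is Euler's Gamma function for s > 0. *)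
Definition Gamma (R : realType) (s : R) : R :=
  \int[lebesgue_measure]_(x in `]0, +oo[) (x `^ (s - 1) * expR (- x)).

Definition student_const (R : realType) (q : R) : R :=
  Gamma ((q + 1) / 2) / (Num.sqrt (q * pi) * Gamma (q / 2)).

Definition student_pdf (R : realType) (q u : R) : R :=
  student_const q * (1 + u ^+ 2 / q) `^ (- ((q + 1) / 2)).

(* X ~ Student(q).  The equality of laws is only required on Borel sets, since
   the value of a measure on a non-measurable set is unconstrained. *)
Definition is_student (R : realType) (d : measure_display)
    (T : measurableType d) (P : probability T R) (X : {RV P >-> R}) (q : R) :
    Prop :=
  forall B : set R, measurable B ->
    distribution P X B = (\int[lebesgue_measure]_(x in B) (student_pdf q x)%:E)%E.

(* E[X^k I{X <= u}], as an extended real; x ^+ 0 = 1 for every x. *)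
Definition truncated_moment (R : realType) (d : measure_display)
    (T : measurableType d) (P : probability T R) (X : {RV P >-> R})
    (k : nat) (u : R) : \bar R :=
  'E_P[fun w : T => X w ^+ k * \1_[set w' | X w' <= u] w].

(* Main.v *)
(* A truncated moment is the integral of x^k p(x) over ]-oo, u].  With
   K_b(x) = (1 + x^2/q)^(-b), p = A_q K_((q+1)/2) and K_b' = - (2b/q) x K_(b+1), so
   x p is an exact derivative, and integration by parts turns x^2 p and x^3 p into
   boundary terms plus multiples of K_((q-1)/2) and x K_((q-1)/2).  Up to the
   rescaling v = x sqrt((q-2)/q), K_((q-1)/2) is the Student(q-2) density.
   No property of Gamma is needed: A_q > 0 because the density has total mass 1. *)

Require Import Defs.
From HB Require Import structures.
From mathcomp Require Import all_boot all_order all_algebra.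
From mathcomp Require Import all_classical all_reals all_analysis.
From mathcomp Require Import measurable_realfun.
From mathcomp Require Import ring lra.
Import Order.TTheory GRing.Theory Num.Theory.
Import numFieldNormedType.Exports.
Local Open Scope classical_set_scope.
Local Open Scope ring_scope.

(** * Integration against a law given by a density *)

(** The formula for [nu] makes [nu] absolutely continuous with respect to [mu]. Its Radon-Nikodym
    derivative has the same integral as [f] over every measurable set, so the two agree almost
    everywhere and [f] can replace the derivative in the change of variables. *)
Lemma integral_density d (T : measurableType d) (R : realType)
    (mu : {sigma_finite_measure set T -> \bar R})
    (nu : {finite_measure set T -> \bar R}) (f : T -> R) (g : T -> \bar R) :
  measurable_fun [set: T] f -> (forall x, 0 <= f x) ->
  (forall A, measurable A -> nu A = \int[mu]_(x in A) (f x)%:E)%E ->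
  measurable_fun [set: T] g -> (forall x, 0 <= g x)%E ->
  (\int[nu]_x g x = \int[mu]_x (g x * (f x)%:E))%E.
Proof.
move=> mf f0 nuE mg g0.
have numu : nu `<< mu.
  apply/null_content_dominatesP => A mA muA0; rewrite nuE//.
  by apply: null_set_integral => //; apply: measurable_funTS; exact/measurable_EFinP.
rewrite -(Radon_Nikodym_SigmaFinite.change_of_variables numu)//.
have ri := Radon_Nikodym_SigmaFinite.f_integrable numu.
apply: ae_eq_integral => //.
- by apply: emeasurable_funM => //; exact: measurable_int ri.
- by apply: emeasurable_funM => //; exact/measurable_EFinP.
apply: ae_eqe_mul2l => /=; apply: integral_ae_eq => //.
  exact/measurable_EFinP.
by move=> E _ mE; rewrite -nuE// -Radon_Nikodym_SigmaFinite.f_integral.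
Qed.

(** The integral is by definition a difference of two nonnegative parts, and each part is
    transferred separately; the equality therefore holds whether or not [g \o X] is integrable. *)
Lemma expectation_density d (T : measurableType d) (R : realType)
    (P : probability T R) (X : {RV P >-> R}) (f g : R -> R) :
  measurable_fun [set: R] f -> (forall x, 0 <= f x) ->
  (forall A, measurable A -> distribution P X A =
    \int[lebesgue_measure]_(x in A) (f x)%:E)%E ->
  measurable_fun [set: R] g ->
  ('E_P[g \o X] = \int[lebesgue_measure]_x (g x * f x)%:E)%E.
Proof.
move=> mf f0 XE mg; rewrite unlock integralE [RHS]integralE.
have mEg : measurable_fun [set: R] (EFin \o g) by exact/measurable_EFinP.
(* [lebesgue_measure] lives on [measurableTypeR R], whose display differs from
   that of the canonical measurable structure on [R] where [X] takes values *)
have mX : @measurable_fun _ _ T (measurableTypeR R) [set: T] X.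
  exact: (measurable_funPT X).
pose X' : {mfun T >-> measurableTypeR R} := 
  @mfun_Sub _ _ T (measurableTypeR R) X (mem_set mX).
have transfer (h : R -> \bar R) : measurable_fun [set: R] h ->
    (forall x, 0 <= h x)%E ->
    (\int[P]_x h (X x) = \int[lebesgue_measure]_x (h x * (f x)%:E))%E.
  move=> mh h0.
  rewrite -(integral_density _ _ R lebesgue_measure (distribution P X') f h)//.
  by rewrite ge0_integral_distribution.
congr (_ - _)%E.
(* Because [f x] is nonnegative, multiplying by it commutes with taking the positive part, and
   likewise the negative part below. *)
- transitivity (\int[P]_x ((EFin \o g)^\+ (X x)))%E.
    by apply: eq_integral => x _; rewrite !funeposE.
  rewrite (transfer _ (measurable_funepos mEg) (funepos_ge0 _)).
  apply: eq_integral => x _; rewrite !funeposE /= EFinM.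
  by rewrite maxe_pMl ?lee_fin// mul0e.
- transitivity (\int[P]_x ((EFin \o g)^\- (X x)))%E.
    by apply: eq_integral => x _; rewrite !funenegE.
  rewrite (transfer _ (measurable_funeneg mEg) (funeneg_ge0 _)).
  apply: eq_integral => x _; rewrite !funenegE /=.
  by rewrite -mulNr EFinM maxe_pMl ?lee_fin// mul0e.
Qed.

(** * The Student density: sign, derivative, continuity *)

Section student_density.
Variables (R : realType) (q : R).
Hypothesis q0 : 0 < q.

Lemma student_base_gt0 (u : R) : 0 < 1 + u ^+ 2 / q.
Proof. by rewrite ltr_pwDl// divr_ge0// ?sqr_ge0// ltW. Qed.

Lemma student_const_ge0 : 0 <= student_const q.
Proof.
have Gamma_ge0 (s : R) : 0 <= Gamma s.
  by apply: Rintegral_ge0 => x _; rewrite mulr_ge0 ?powR_ge0 ?expR_ge0.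
by rewrite /student_const divr_ge0 ?mulr_ge0 ?sqrtr_ge0.
Qed.

Lemma student_pdf_ge0 (u : R) : 0 <= student_pdf q u.
Proof. by rewrite mulr_ge0 ?student_const_ge0 ?powR_ge0. Qed.

Lemma is_derive_student_base (b t : R) :
  is_derive t 1 (fun u : R => (1 + u ^+ 2 / q) `^ b)
    (2 * b / q * t * (1 + t ^+ 2 / q) `^ (b - 1)).
Proof.
have d1 : is_derive t 1 (fun u : R => 1 + u ^+ 2 / q) (2 * t / q).
  apply: is_derive_eq; rewrite -mulr_natl /GRing.scale/=; ring.
have := @is_derive1_comp _ _ _ t _ _ (is_derive1_powR b (student_base_gt0 t)) d1.
by rewrite (_ : _ * _ = 2 * b / q * t * (1 + t ^+ 2 / q) `^ (b - 1))//; ring.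
Qed.

Lemma continuous_student_base (b : R) :
  continuous (fun u : R => (1 + u ^+ 2 / q) `^ b).
Proof.
move=> x; apply/differentiable_continuous/derivable1_diffP.
by have [] := is_derive_student_base b x.
Qed.

End student_density.

(** * The fundamental theorem of calculus on ]-oo, u] *)

(** A sign condition near -oo is enough. Left of a cut point [b], where [f] is nonnegative, the
    reflection x -> -x leads to the theorem on a half-line going to +oo; on [b, u] the theorem for
    continuous functions applies whatever the sign. *)
Lemma ge0_FTC2Ny (R : realType) (f F : R -> R) (a l u : R) :
  continuous f -> (forall x : R, is_derive x 1 F (f x)) ->
  F x @[x --> -oo] --> l -> (forall x, x <= a -> 0 <= f x) ->
  (\int[lebesgue_measure]_(x in `]-oo, u]) (f x)%:E = (F u - l)%:E)%E.
Proof.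
(* Subtracting 1 makes [b < u] strict, as the theorem on a compact interval requires. *)
move=> cf dF Fl f0; pose b := Num.min a u - 1.
have ba : b <= a by rewrite lerBlDr ge_min lerDl ler01.
have bu : b < u by rewrite ltrBlDr gt_min (ltrDl u) ltr01 orbT.
have cF : continuous F.
  by move=> x; apply/differentiable_continuous/derivable1_diffP; case: (dF x).
have mf D : measurable_fun D (EFin \o f).
  by apply: measurable_funTS; apply/measurable_EFinP; exact: continuous_measurable_fun.
have -> : [set` `]-oo, u]] = `]-oo, b] `|` `]b, u].
  by rewrite -itv_bndbnd_setU// bnd_simp ltW.
rewrite integral_setU//; last 2 first.
- exact: mf.
- rewrite disj_set2E; apply/eqP; rewrite -subset0 => x [] /=.
  by rewrite !in_itv/= => xb /andP[]; rewrite ltNge xb.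
rewrite integral_itv_obnd_cbnd; last exact: mf.
rewrite (@continuous_FTC2 _ f F b u)//; last 3 first.
- exact: continuous_subspaceT.
- split.
  + by move=> x _; case: (dF x).
  + exact/cvg_at_right_filter/cF.
  + exact/cvg_at_left_filter/cF.
- by move=> x _; rewrite derive1E; case: (dF x).
have dFN (x : R) : is_derive x 1 (fun y => - F (- y)) (f (- x)).
  have := @is_derive1_comp _ F -%R x _ _ (dF (- x)) (is_deriveN (is_derive_id _ _)).
  move/is_deriveN; rewrite mulrN1 opprK; exact.
have -> : (\int[lebesgue_measure]_(x in `]-oo, b]) (f x)%:E = (F b - l)%:E)%E.
  rewrite -{1}(opprK b) ge0_integration_by_substitutionNy; last 2 first.
  - exact: continuous_subspaceT.
  - move=> x; rewrite in_itv/= opprK => xb; apply: f0.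
    exact: le_trans (ltW xb) ba.
  rewrite (@ge0_continuous_FTC2y _ (f \o -%R) (fun y => - F (- y)) _ (- l)).
  - by rewrite opprK -EFinB opprK addrC.
  - by move=> x bx /=; apply: f0; apply: le_trans ba; rewrite lerNl.
  - apply: continuous_subspaceT => x; apply: continuous_comp.
      exact: opp_continuous.
    by [exact: cf|exact: cF].
  - by move/cvgNy_compNP : Fl => /cvgN.
  - by move=> x _; case: (dFN x).
  - apply: cvg_at_right_filter; apply: cvgN; apply: continuous_comp.
      exact: opp_continuous.
    by [exact: cf|exact: cF].
  - by move=> x _; rewrite derive1E; case: (dFN x).
by rewrite -EFinB -EFinD; congr EFin; rewrite addrC subrKA.
Qed.

(** With the convention that +oo - +oo is -oo, a finite integral forces the positive and negative
    parts to have finite integrals. *)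
Lemma integrable_fin_integral d (T : measurableType d) (R : realType)
    (mu : {measure set T -> \bar R}) (D : set T) (f : T -> \bar R) :
  measurable D -> measurable_fun D f ->
  (\int[mu]_(x in D) f x)%E \is a fin_num -> mu.-integrable D f.
Proof.
move=> mD mf; rewrite fin_num_abs => intf.
by apply/integrableP; split => //; exact/abse_integralP.
Qed.

Lemma le0_FTC2Ny (R : realType) (f F : R -> R) (a l u : R) :
  continuous f -> (forall x : R, is_derive x 1 F (f x)) ->
  F x @[x --> -oo] --> l -> (forall x, x <= a -> f x <= 0) ->
  (\int[lebesgue_measure]_(x in `]-oo, u]) (f x)%:E = (F u - l)%:E)%E.
Proof.
move=> cf dF Fl f0.
have cfN : continuous (\- f) by move=> x; exact/continuousN/cf.
have intN : (\int[lebesgue_measure]_(x in `]-oo, u]) ((\- f) x)%:E =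
    (- F u + l)%:E)%E.
  rewrite (@ge0_FTC2Ny R (\- f) (\- F) a (- l) u) ?opprK//.
  - exact: cvgN.
  - by move=> x xa; rewrite oppr_ge0 f0.
(* Pulling out the factor -1 requires integrability, which follows from the finite value in
   [intN]. *)
under eq_integral do rewrite -(opprK (f _)) -mulN1r EFinM.
rewrite integralZl//=; last first.
  apply: integrable_fin_integral => //; last by rewrite intN.
  by apply/measurable_EFinP/measurable_funTS; exact: continuous_measurable_fun.
by rewrite intN -EFinM; congr EFin; ring.
Qed.

(** * Truncated moments as Lebesgue integrals, and decay at -oo *)

Section student_moments.
Variables (R : realType) (q : R).
Hypothesis q0 : 0 < q.

Lemma continuous_student_pdf : continuous (student_pdf q).
Proof.
move=> x; apply: cvgM; first exact: cvg_cst.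
exact: (continuous_student_base R q q0).
Qed.

Lemma truncated_momentE d (T : measurableType d) (P : probability T R)
    (X : {RV P >-> R}) (k : nat) (u : R) :
  is_student X q ->
  (truncated_moment X k u =
   \int[lebesgue_measure]_(x in `]-oo, u]) (x ^+ k * student_pdf q x)%:E)%E.
Proof.
move=> hX; rewrite /truncated_moment.
have -> : (fun w : T => X w ^+ k * \1_[set w' | X w' <= u] w) =
    (fun x => x ^+ k * \1_`]-oo, u] x) \o X.
  apply/funext => w /=; congr (_ * _).
rewrite (@expectation_density _ _ _ _ X (student_pdf q))//; last 3 first.
- exact: continuous_measurable_fun continuous_student_pdf.
- exact: student_pdf_ge0.
- by apply: measurable_funM => //; exact: measurable_indic.
rewrite [RHS]integral_mkcond; apply: eq_integral => x _.
rewrite patchE indicE; case: ifPn => _ /=; first by rewrite mulr1.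
by rewrite mulr0 mul0r.
Qed.

(** Used for the constant of index [q - 2], which the theorem has in a denominator. *)
Lemma is_student_const_gt0 d (T : measurableType d) (P : probability T R)
    (X : {RV P >-> R}) : is_student X q -> 0 < student_const q.
Proof.
move=> hX; rewrite lt_neqAle student_const_ge0 andbT eq_sym.
apply/eqP => A0; have := hX setT measurableT.
rewrite probability_setT integral0_eq; last first.
  by move=> x _; rewrite /student_pdf A0 mul0r.
by move/eqP; rewrite onee_eq0.
Qed.

(** The integer [n] reduces the claim to natural powers: for |x| >= 1, |x|^j <= |x|^(2n) and the
    real power is at most (q / x^2)^(n+1), so the product is bounded by q^(n+1) / x^2, hence by
    q^(n+1) / |x|. *)
Lemma cvg_student_base_Ny (j n : nat) (b : R) : (j <= n.*2)%N -> n.+1%:R <= b ->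
  (x ^+ j * (1 + x ^+ 2 / q) `^ (- b)) @[x --> -oo] --> (0 : R).
Proof.
move=> jn nb; apply/norm_cvg0P.
have lim0 : q ^+ n.+1 * (- x)^-1 @[x --> -oo] --> (0 : R).
  rewrite -[X in _ --> X](mulr0 (q ^+ n.+1)); apply: cvgMr.
  apply/gtr0_cvgV0.
    by near=> x; rewrite oppr_gt0; near: x; exact: nbhs_ninfty_lt.
  by apply/cvgNry; exact: cvg_id.
apply: (squeeze_cvgr _ (cvg_cst 0) lim0); near=> x.
have x1 : x <= - 1 by near: x; exact: nbhs_ninfty_le.
rewrite normr_ge0/=.
have xn : `|x| = - x by rewrite ler0_norm//; lra.
have x1' : 1 <= `|x| by rewrite xn; lra.
set y := 1 + x ^+ 2 / q.
have y1 : 1 <= y by rewrite lerDl divr_ge0 ?sqr_ge0// ltW.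
have y0 : 0 < y by lra.
rewrite normrM normrX (ger0_norm (powR_ge0 _ _)) -xn.
apply: (@le_trans _ _ (`|x| ^+ n.*2 * (q / x ^+ 2) ^+ n.+1)).
  apply: ler_pM => //.
  - exact: powR_ge0.
  - exact: ler_weXn2l.
  - apply: (@le_trans _ _ (y ^- n.+1)).
      rewrite powRN -(powR_mulrn n.+1 (ltW y0)) lef_pV2 ?posrE ?powR_gt0//.
      exact: ler_powR.
    rewrite -exprVn lerXn2r ?nnegrE ?invr_ge0 ?divr_ge0 ?sqr_ge0 ?(ltW y0) ?(ltW q0)//.
    rewrite -[leRHS]invf_div lef_pV2 ?posrE// ?lerDr//.
    by rewrite divr_gt0// -(real_normK (num_real x)) exprn_gt0//; lra.
rewrite -(real_normK (num_real x)) expr_div_n -exprM mul2n doubleS !exprSr.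
have z0 : `|x| != 0 by apply/eqP => z; move: x1'; rewrite z; lra.
have zn0 : `|x| ^+ n.*2 != 0 by rewrite expf_neq0.
rewrite (_ : _ * (_ / _) = q ^+ n.+1 * `|x|^-1 * `|x|^-1); last first.
  by rewrite exprSr; field; rewrite z0 zn0.
rewrite exprSr ler_piMr// ?invf_le1//; last by lra.
by rewrite mulr_ge0 ?mulr_ge0 ?exprn_ge0 ?invr_ge0// ltW.
Unshelve. all: end_near. Qed.

End student_moments.

(** * Explicit antiderivatives for orders 1, 3 and 2 *)

Section student_integrals.
Variables (R : realType) (q : R).
Hypothesis q0 : 0 < q.

Let K (b x : R) := (1 + x ^+ 2 / q) `^ (- b).

Let cK (b : R) : continuous (K b).
Proof. exact: continuous_student_base. Qed.

Let dK (b x : R) : is_derive x 1 (K b) (- (2 * b / q) * x * K (b + 1) x).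
Proof.
rewrite /K opprD (_ : - (2 * b / q) = 2 * - b / q); last by field; rewrite gt_eqF.
exact: is_derive_student_base.
Qed.

(** The exponent is written as (q - 1)/2 + 1 to match the shift by one in [dK]. *)
Let student_pdfE (x : R) : student_pdf q x = student_const q * K ((q - 1) / 2 + 1) x.
Proof. by rewrite /student_pdf /K; congr (_ * _ `^ (- _)); field. Qed.

(** The factor for which [- c * K ((q - 1) / 2)] is an antiderivative of x p(x). *)
Let c : R := q / (q - 1) * student_const q.

Let cvgK (j n : nat) (b a : R) : (j <= n.*2)%N -> n.+1%:R <= b ->
  a * (x ^+ j * K b x) @[x --> -oo] --> (0 : R).
Proof.
move=> jn nb; rewrite -[X in _ --> X](mulr0 a); apply: cvgMr.
exact: cvg_student_base_Ny jn nb.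
Qed.

Let continuous_powM_pdf (k : nat) :
  continuous (fun x : R => x ^+ k * student_pdf q x).
Proof.
move=> x; apply: cvgM; first exact: exprn_continuous.
exact: continuous_student_pdf.
Qed.

Lemma student_integral1 (u : R) : 3 <= q ->
  (\int[lebesgue_measure]_(x in `]-oo, u]) (x ^+ 1 * student_pdf q x)%:E =
   (- (c * (1 + u ^+ 2 / q) `^ (- ((q - 1) / 2))))%:E)%E.
Proof.
move=> q3.
(* The factor [x ^+ 0] gives [F] the shape expected by [cvgK]. *)
pose F x := - c * (x ^+ 0 * K ((q - 1) / 2) x).
have dF (x : R) : is_derive x 1 F (x ^+ 1 * student_pdf q x).
  have d := dK ((q - 1) / 2) x.
  rewrite (_ : F = fun x => - c * K ((q - 1) / 2) x); last first.
    by apply/funext => y; rewrite /F expr0 mul1r.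
  apply: is_derive_eq; rewrite student_pdfE /GRing.scale/= /c.
  by field; rewrite !gt_eqF//; lra.
rewrite (@le0_FTC2Ny _ _ F 0 0 u _ dF).
- by rewrite subr0 /F expr0 mul1r mulNr.
- exact: continuous_powM_pdf.
- by apply: (@cvgK 0 0) => //; lra.
- by move=> x x0; rewrite expr1 mulr_le0_ge0 ?student_pdf_ge0.
Qed.

(** Integrating x^2 (x p) by parts leaves 2 c x K_((q-1)/2), whose antiderivative is a multiple of
    K_((q-3)/2). Both boundary terms vanish at -oo by [cvgK], whose conditions 2 <= (q-1)/2 and 1 <=
    (q-3)/2 each amount to [5 <= q]. *)
Lemma student_integral3 (u : R) : 5 <= q ->
  (\int[lebesgue_measure]_(x in `]-oo, u]) (x ^+ 3 * student_pdf q x)%:E =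
   (- (c * u ^+ 2 * (1 + u ^+ 2 / q) `^ (- ((q - 1) / 2)))
    - 2 * q / (q - 3) * c * (1 + u ^+ 2 / q) `^ (- ((q - 3) / 2)))%:E)%E.
Proof.
move=> q5.
pose F x := - c * (x ^+ 2 * K ((q - 1) / 2) x)
  + - (2 * q / (q - 3) * c) * (x ^+ 0 * K ((q - 3) / 2) x).
have dF (x : R) : is_derive x 1 F (x ^+ 3 * student_pdf q x).
  have d1 := dK ((q - 1) / 2) x; have d2 := dK ((q - 3) / 2) x.
  rewrite (_ : F = fun x => - c * (x ^+ 2 * K ((q - 1) / 2) x)
      + - (2 * q / (q - 3) * c) * K ((q - 3) / 2) x); last first.
    by apply/funext => y; rewrite /F expr0 mul1r.
  apply: is_derive_eq; rewrite student_pdfE /GRing.scale/= /c.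
  rewrite (_ : (q - 3) / 2 + 1 = (q - 1) / 2); last by field.
  by field; rewrite !gt_eqF//; lra.
rewrite (@le0_FTC2Ny _ _ F 0 0 u _ dF).
- by congr EFin; rewrite subr0 /F /K; ring.
- exact: continuous_powM_pdf.
- rewrite -[X in _ --> X]addr0; apply: cvgD.
    by apply: (@cvgK 2 1) => //; lra.
  by apply: (@cvgK 0 0) => //; lra.
- move=> x x0; rewrite mulr_le0_ge0 ?student_pdf_ge0//.
  by rewrite exprS mulr_le0_ge0// sqr_ge0.
Qed.

(* [x ^+ 2 * student_pdf q x] alone has no elementary antiderivative *)
Lemma student_integral2B (u : R) : 5 <= q ->
  (\int[lebesgue_measure]_(x in `]-oo, u]) (x ^+ 2 * student_pdf q x
     - c * (1 + x ^+ 2 / q) `^ (- ((q - 1) / 2)))%:E =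
   (- (c * u * (1 + u ^+ 2 / q) `^ (- ((q - 1) / 2))))%:E)%E.
Proof.
move=> q5.
pose F x := - c * (x ^+ 1 * K ((q - 1) / 2) x).
have dF (x : R) : is_derive x 1 F (x ^+ 2 * student_pdf q x - c * K ((q - 1) / 2) x).
  have d := dK ((q - 1) / 2) x.
  apply: is_derive_eq; rewrite student_pdfE /GRing.scale/= -/(K _ x) /c.
  by field; rewrite !gt_eqF//; lra.
(* The integrand has the sign of (q - 2) x^2 - q. For x <= -2 this is at least 3 q - 8, which is
   positive since [5 <= q]. *)
rewrite (@ge0_FTC2Ny _ _ F (- 2) 0 u _ dF).
- by congr EFin; rewrite subr0 /F /K; ring.
- move=> x; apply: cvgB; first exact: continuous_powM_pdf.
  by apply: cvgMr; exact: cK.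
- by apply: (@cvgK 1 1) => //; lra.
- move=> x x2; have y0 := student_base_gt0 R q q0 x.
  rewrite student_pdfE /K opprD powRD; last by apply/implyP => _; rewrite gt_eqF.
  rewrite powR_inv1 ?(ltW y0)//.
  set k := _ `^ _; have k0 : 0 <= k by exact: powR_ge0.
  have A0 : 0 <= student_const q by exact: student_const_ge0.
  rewrite (_ : _ - _ = student_const q * k * (1 + x ^+ 2 / q)^-1 / (q - 1)
    * ((q - 2) * x ^+ 2 - q)); last first.
    have yq : 0 < q + x ^+ 2 by rewrite ltr_pwDl ?sqr_ge0.
    by rewrite /c; field; rewrite !gt_eqF//; lra.
  have x4 : 4 <= x ^+ 2 by rewrite expr2; nra.
  rewrite mulr_ge0//; last by nra.
  by apply: divr_ge0; [apply: divr_ge0; [exact: mulr_ge0|exact: ltW]|lra].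
Qed.

End student_integrals.

(** * Rescaling the Student density of index q - 2 *)

(** Since s^2 / (q - 2) = 1 / q, putting v = x s turns 1 + v^2 / (q - 2) into 1 + x^2 / q; the extra
    factor [s] is the Jacobian. *)
Lemma student_substitution (R : realType) (q u : R) : 2 < q ->
  let s := Num.sqrt ((q - 2) / q) in
  (\int[lebesgue_measure]_(x in `]-oo, (u * s)%R]) (student_pdf (q - 2) x)%:E =
   \int[lebesgue_measure]_(x in `]-oo, u])
     (student_const (q - 2) * s * (1 + x ^+ 2 / q) `^ (- ((q - 1) / 2)))%:E)%E.
Proof.
move=> q2 s; have q20 : 0 < q - 2 by lra.
have q0 : 0 < q by lra.
have s0 : 0 < s by rewrite sqrtr_gt0 divr_gt0.
have s2 : s ^+ 2 = (q - 2) / q by rewrite sqr_sqrtr// divr_ge0 ?ltW.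
have dF (x : R) : is_derive x 1 (fun y => y * s) s.
  by apply: is_derive_eq; rewrite /GRing.scale/=; ring.
have F' : (fun y => y * s)^`()%classic = cst s.
  by apply/funext => x; rewrite derive1E; case: (dF x).
have cF : continuous (fun y : R => y * s) by move=> x; exact: mulrr_continuous.
rewrite (@increasing_ge0_integration_by_substitutionNy R (fun y => y * s)).
- apply: eq_integral => x _; rewrite F' /= /student_pdf.
  congr EFin; rewrite mulrAC; congr (_ * _ `^ _); last by field.
  rewrite exprMn s2; congr (1 + _); field.
  by rewrite !gt_eqF.
- by move=> x y _ _ xy; rewrite ltr_pM2r.
- by rewrite F' => x _; exact: cvg_cst.
- by rewrite F'; exact: is_cvg_cst.
- by rewrite F'; exact: cvg_cst.
- split; first by move=> x _; case: (dF x).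
  exact/cvg_at_left_filter/cF.
- exact: gt0_cvgMlNy.
- apply: continuous_subspaceT; exact: continuous_student_pdf.
- by move=> x _; exact: student_pdf_ge0.
Qed.

(** * Assembly of the four formulas *)

Theorem proposition11 (R : realType) (q : R) (hq : 5 < q)
    (d : measure_display) (T : measurableType d) (P : probability T R)
    (W : {RV P >-> R}) (hW : is_student W q)
    (d' : measure_display) (T' : measurableType d') (P' : probability T' R)
    (V : {RV P' >-> R}) (hV : is_student V (q - 2)) (u : R) :
  [/\ truncated_moment W 0 u =
        (\int[lebesgue_measure]_(t in `]-oo, u]) (student_pdf q t)%:E)%E,
      truncated_moment W 1 u =
        (- (q / (q - 1) * student_const q
            * (1 + u ^+ 2 / q) `^ (- ((q - 1) / 2))))%:E,
      truncated_moment W 2 u =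
        ((q `^ (3 / 2) / (Num.sqrt (q - 2) * (q - 1))
            * (student_const q / student_const (q - 2)))%:E
           * truncated_moment V 0 (u * Num.sqrt ((q - 2) / q))
         - (q / (q - 1) * student_const q * u
              * (1 + u ^+ 2 / q) `^ (- ((q - 1) / 2)))%:E)%E
    & truncated_moment W 3 u =
        ((2 * q ^+ 2 / ((q - 2) * (q - 1))
            * (student_const q / student_const (q - 2)))%:E
           * truncated_moment V 1 (u * Num.sqrt ((q - 2) / q))
         - (q / (q - 1) * student_const q * u ^+ 2
              * (1 + u ^+ 2 / q) `^ (- ((q - 1) / 2)))%:E)%E].
Proof.
have q0 : 0 < q by lra.
have q20 : 0 < q - 2 by lra.
have A2 := is_student_const_gt0 R (q - 2) _ _ _ _ hV.
set s := Num.sqrt ((q - 2) / q).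
have s0 : 0 < s by rewrite sqrtr_gt0 divr_gt0.
have s2 : s ^+ 2 = (q - 2) / q by rewrite sqr_sqrtr// divr_ge0 ?ltW.
have base : 1 + (u * s) ^+ 2 / (q - 2) = 1 + u ^+ 2 / q.
  by rewrite exprMn s2; field; rewrite !gt_eqF.
rewrite !(truncated_momentE R q q0 _ _ _ _ _ _ hW).
rewrite !(truncated_momentE R (q - 2) q20 _ _ _ _ _ _ hV).
split.
- by under eq_integral do rewrite expr0 mul1r.
- by rewrite student_integral1//; lra.
(* The Jacobian [s] absorbs the square roots of the stated coefficient, leaving the factor q / (q -
   1). *)
- have sE : q `^ (3 / 2) / (Num.sqrt (q - 2) * (q - 1)) * s = q / (q - 1).
    have -> : q `^ (3 / 2) = q * Num.sqrt q.
      rewrite (_ : 3 / 2 = 1 + 2^-1) ?powRD ?powRr1 ?powR12_sqrt ?ltW//.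
        by apply/implyP => _; rewrite gt_eqF.
      by field.
    rewrite /s sqrtrM ?ltW// sqrtrV ?ltW//.
    have ? : 0 < Num.sqrt q by rewrite sqrtr_gt0.
    have ? : 0 < Num.sqrt (q - 2) by rewrite sqrtr_gt0.
    by field; rewrite !gt_eqF//; lra.
  under [in RHS]eq_integral do rewrite expr0 mul1r.
  (* This integral is a probability, hence finite; after the substitution it yields the
     integrability [intN]. *)
  have : (\int[lebesgue_measure]_(x in `]-oo, (u * s)%R])
      (student_pdf (q - 2) x)%:E)%E \is a fin_num.
    by rewrite -hV// fin_num_measure.
  rewrite student_substitution; last by lra.
  rewrite -/s => Nfin.
  set C := (X in (X%:E * _)%E).
  (* Thus [C] times the rescaled density is exactly the term subtracted in [student_integral2B];
     adding it back recovers x^2 p(x). *)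
  have CE : C * (student_const (q - 2) * s) = q / (q - 1) * student_const q.
    by rewrite -sE /C; field; rewrite !gt_eqF// ?sqrtr_gt0//; lra.
  have q5 := ltW hq.
  pose K (x : R) := (1 + x ^+ 2 / q) `^ (- ((q - 1) / 2)).
  have mK : measurable_fun [set: R] K.
    by apply: continuous_measurable_fun; exact: continuous_student_base.
  have mX2 : measurable_fun [set: R] (fun x => x ^+ 2 * student_pdf q x).
    apply: measurable_funM => //.
    apply: continuous_measurable_fun; exact: continuous_student_pdf.
  have intN : lebesgue_measure.-integrable `]-oo, u]
      (fun x => (student_const (q - 2) * s * K x)%:E).
    apply: integrable_fin_integral => //.
    by apply/measurable_EFinP/measurable_funTS; exact: measurable_funM.
  have intB : lebesgue_measure.-integrable `]-oo, u]
      (fun x => (x ^+ 2 * student_pdf q x - q / (q - 1) * student_const q * K x)%:E).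
    apply: integrable_fin_integral => //; last by rewrite student_integral2B.
    apply/measurable_EFinP/measurable_funTS/measurable_funB => //.
    exact: measurable_funM.
  transitivity (\int[lebesgue_measure]_(x in `]-oo, u])
      ((x ^+ 2 * student_pdf q x - q / (q - 1) * student_const q * K x)%:E
       + C%:E * (student_const (q - 2) * s * K x)%:E))%E.
    apply: eq_integral => x _; rewrite -EFinM -EFinD (mulrA C) CE.
    by rewrite subrK.
  rewrite integralD//=; last exact: integrableZl.
  by rewrite student_integral2B// integralZl// addeC.
(* The first moment of [V] has the closed form for index [q - 2], valid as 3 <= q - 2; [base]
   expresses it through 1 + u^2 / q, and only the constants remain to be compared. *)
- rewrite student_integral1//; last by lra.
  rewrite student_integral3//; last exact: ltW.
  rewrite base (_ : q - 2 - 1 = q - 3); last by ring.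
  rewrite -EFinM -EFinB; congr EFin.
  by field; rewrite !gt_eqF//; lra.
Qed.
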